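(* Let $K,N\ge 1$, let $c_1^M,\dots,c_K^M>0$ with $C^M=\sum_k c_k^M$, let $0\le r_1<r_2<\dots<r_K$, let $p=(p_1,\dots,p_N)$ with $p_i\ge 0$ and $p_{\max}=\max_ip_i$, and let $\epsilon$ be a random vector with a known distribution on $[0,1]^N$. With $\mathcal{F}_c$, $k_c$ and $\mathrm{cost}(\epsilon,c)$ as defined in the context, the function $f(c)=\mathbb{E}_\epsilon[\mathrm{cost}(\epsilon,c)]$ is convex on $\mathcal{F}_c$, and the output $\bar c_J$ of the projected stochastic subgradient descent algorithm described in the context satisfies $\mathbb{E}[f(\bar c_J)]\to\min_{c\in\mathcal{F}_c}f(c)$ as $J\to\infty$.
   Context: Feasible region: $\mathcal{F}_c=\{c\in\mathbb{R}^N: c\ge 0,\ \sum_{i=1}^N c_i\le C^M\}$. For $\epsilon\in[0,1]^N$ and $c\in\mathcal{F}_c$, the critical type is $k_c=\min\{q\in\{1,\dots,K\}:\sum_i\epsilon_ic_i\le\sum_{k=1}^q c_k^M\}$, and $\mathrm{cost}(\epsilon,c)=\sum_{k<k_c}(r_k-r_{k_c})c_k^M+\sum_{i=1}^N c_i(r_{k_c}\epsilon_i-p_i)$ (the optimal net cost of a cryptomining facility with $K$ machine types of capacities $c_k^M$ and per-unit mining rewards $r_k$, committing capacities $c_i$ to $N$ ancillary service programs with prices $p_i$ and deployment ratios $\epsilon_i$). Algorithm: let $D=C^M$ if $N=1$ and $D=\sqrt2\,C^M$ if $N\ge 2$; fix $M\ge1$ and $J\ge 1$, step sizes $\alpha_j=\frac{D}{\sqrt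 N\max(r_K,p_{\max})\sqrt j}$. Start from some $c^{(1)}\in\mathcal{F}_c$. For $j=1,\dots,J$: draw $M$ independent samples $\epsilon^{(1)},\dots,\epsilon^{(M)}$ of $\epsilon$, compute $g_j=\frac1M\sum_{m=1}^M\big(r_{k_c^{(m)}}\epsilon^{(m)}-p\big)$ where $k_c^{(m)}$ is the critical type for $(\epsilon^{(m)},c^{(j)})$, set $c^{(j+1)}$ to be the Euclidean projection of $c^{(j)}-\alpha_jg_j$ onto $\mathcal{F}_c$. Output $\bar c_J=\frac1J\sum_{j=1}^Jc^{(j)}$. *)

(* Defs.v *)
From HB Require Import structures.
From mathcomp Require Import all_boot all_order all_algebra.
From mathcomp Require Import all_classical all_reals all_analysis.

Set Implicit Arguments.
Unset Strict Implicit.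
Unset Printing Implicit Defensive.

Import Order.TTheory GRing.Theory Num.Theory.
Local Open Scope classical_set_scope.
Local Open Scope ring_scope.

(* Indices are 0-based: machine types k = 0..K-1 (paper: 1..K),
   ancillary programs i : 'I_N. Capacity vectors c are row vectors 'rV[R]_N;
   realizations of epsilon are N-tuples (N.-tuple R carries the product
   sigma-algebra in MathComp-Analysis). *)

Definition inF (R : realType) (N : nat) (CM : R) (c : 'rV[R]_N) : Prop :=
  (forall i, 0 <= c 0 i) /\ \sum_(i < N) c 0 i <= CM.

(* critical type k_c (0-based): the least q in {0..K-1} with
   sum_i eps_i c_i <= sum_{k <= q} cM_k; returns K if there is none
   (never happens for c in F_c and eps in [0,1]^N). *)
Definition kcrit (R : realType) (K N : nat) (cM : nat -> R)
  (e : N.-tuple R) (c : 'rV[R]_N) : nat :=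
  find (fun q => \sum_(i < N) tnth e i * c 0 i <= \sum_(k < q.+1) cM k)
       (iota 0 K).

Definition cost (R : realType) (K N : nat) (cM r : nat -> R) (p : 'rV[R]_N)
  (e : N.-tuple R) (c : 'rV[R]_N) : R :=
  let k := kcrit K cM e c in
  \sum_(j < k) (r j - r k) * cM j + \sum_(i < N) c 0 i * (r k * tnth e i - p 0 i).

Definition sqnorm (R : realType) (N : nat) (v : 'rV[R]_N) : R :=
  \sum_(i < N) v 0 i ^+ 2.

Definition is_proj_F (R : realType) (N : nat) (CM : R)
  (proj : 'rV[R]_N -> 'rV[R]_N) : Prop :=
  forall x, inF CM (proj x) /\
    (forall z, inF CM z -> sqnorm (proj x - x) <= sqnorm (z - x)).

Definition tvec (R : realType) (N : nat) (e : N.-tuple R) : 'rV[R]_N :=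
  \row_i tnth e i.

Definition pmax (R : realType) (N : nat) (p : 'rV[R]_N) : R :=
  \big[Num.max/0]_(i < N) p 0 i.

Definition stepsize (R : realType) (K N : nat) (CM : R) (r : nat -> R)
  (p : 'rV[R]_N) (j : nat) : R :=
  let D := if N == 1%N then CM else Num.sqrt 2 * CM in
  D / (Num.sqrt N%:R * Num.max (r K.-1) (pmax p) * Num.sqrt j%:R).

(* averaged stochastic subgradient g_j at iterate c, batch n = j-1 *)
Definition subgrad (R : realType) (K N M : nat) (cM r : nat -> R)
  (p : 'rV[R]_N) {T : Type} (X : nat -> 'I_M -> T -> N.-tuple R)
  (n : nat) (c : 'rV[R]_N) (w : T) : 'rV[R]_N :=
  (M%:R)^-1 *: \sum_(m < M) (r (kcrit K cM (X n m w) c) *: tvec (X n m w) - p).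

(* psgd n w = c^{(n+1)}: psgd 0 = c^{(1)}, and
   c^{(j+1)} = proj (c^{(j)} - alpha_j g_j), g_j using the samples X (j-1) m *)
Fixpoint psgd (R : realType) (K N M : nat) (CM : R) (cM r : nat -> R)
  (p : 'rV[R]_N) (proj : 'rV[R]_N -> 'rV[R]_N) (c1 : 'rV[R]_N)
  {T : Type} (X : nat -> 'I_M -> T -> N.-tuple R) (n : nat) (w : T)
  : 'rV[R]_N :=
  match n with
  | 0 => c1
  | n'.+1 =>
      let c := psgd K CM cM r p proj c1 X n' w in
      proj (c - stepsize K CM r p n *: subgrad K cM r p X n' c w)
  end.

Definition cbar (R : realType) (K N M : nat) (CM : R) (cM r : nat -> R)
  (p : 'rV[R]_N) (proj : 'rV[R]_N -> 'rV[R]_N) (c1 : 'rV[R]_N)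
  {T : Type} (X : nat -> 'I_M -> T -> N.-tuple R) (J : nat) (w : T)
  : 'rV[R]_N :=
  (J%:R)^-1 *: \sum_(n < J) psgd K CM cM r p proj c1 X n w.

Definition mutually_independent (R : realType) (d d' : measure_display)
  (Omega : measurableType d) (T : measurableType d') (I : eqType)
  (P : probability Omega R) (X : I -> Omega -> T) : Prop :=
  forall (S : seq I) (B : I -> set T), uniq S ->
    (forall i, i \in S -> measurable (B i)) ->
    P (\bigcap_(i in [set` S]) (X i @^-1` B i)) =
    (\prod_(i <- S) P (X i @^-1` B i))%E.

Definition fexp (R : realType) (d : measure_display) (Omega : measurableType d)
  (P : probability Omega R) (K N : nat) (cM r : nat -> R) (p : 'rV[R]_N)
  (eps : Omega -> N.-tuple R) (c : 'rV[R]_N) : R :=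
  fine (\int[P]_w (cost K cM r p (eps w) c)%:E)%E.

Definition convex_on_F (R : realType) (N : nat) (CM : R) (f : 'rV[R]_N -> R)
  : Prop :=
  forall (c c' : 'rV[R]_N) (t : R), inF CM c -> inF CM c' -> 0 <= t <= 1 ->
    f (t *: c + (1 - t) *: c') <= t * f c + (1 - t) * f c'.

(* Main.v *)
(** The cost is the maximum over the machine types of affine functions of [c],
    attained at the critical type, so it is convex in [c] with subgradient
    [r_kc e - p].  The rest holds for any random convex loss on a bounded convex
    set.  Nonexpansiveness of the projection and a telescoping argument bound
    the linearized regret of the first J iterates by [C * sqrt J], with the same
    [C] for every outcome.  The n-th iterate depends only on earlier batches, so
    it is independent of the n-th batch, and Fubini turns the loss of a sample
    at that iterate into the expected risk of the iterate.  After integration,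
    Jensen's inequality for the average iterate gives an excess risk of at most
    [C / sqrt J]. *)
Require Import Defs.
From HB Require Import structures.
From mathcomp Require Import all_boot all_order all_algebra.
From mathcomp Require Import all_classical all_reals all_analysis.
From mathcomp Require Import measurable_realfun ring lra.

Set Implicit Arguments.
Unset Strict Implicit.
Unset Printing Implicit Defensive.

Import Order.TTheory GRing.Theory Num.Theory.
Import numFieldNormedType.Exports.
Local Open Scope classical_set_scope.
Local Open Scope ring_scope.

(** * Convexity and projections *)

Lemma sum_ord_le_const (R : numDomainType) (n : nat) (F : 'I_n -> R) (b : R) :
  (forall i, F i <= b) -> \sum_i F i <= n%:R * b.
Proof.
move=> Fb; rewrite mulr_natl -[X in _ *+ X]card_ord -sumr_const.
by apply: ler_sum => i _; exact: Fb.
Qed.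

Definition dotp (R : realType) (N : nat) (u v : 'rV[R]_N) : R :=
  \sum_(i < N) u 0 i * v 0 i.

Section euclidean.
Context (R : realType) (N : nat).
Implicit Types u v : 'rV[R]_N.

Lemma dotpC u v : dotp u v = dotp v u.
Proof. by apply: eq_bigr => i _; rewrite mulrC. Qed.

Lemma dotpZr t u v : dotp u (t *: v) = t * dotp u v.
Proof. by rewrite mulr_sumr; apply: eq_bigr => i _; rewrite mxE mulrCA. Qed.

Lemma dotpZl t u v : dotp (t *: u) v = t * dotp u v.
Proof. by rewrite dotpC dotpZr dotpC. Qed.

Lemma dotpNr u v : dotp u (- v) = - dotp u v.
Proof. by rewrite -scaleN1r dotpZr mulN1r. Qed.

Lemma dotp_suml (I : Type) (s : seq I) (F : I -> 'rV[R]_N) v :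
  dotp (\sum_(i <- s) F i) v = \sum_(i <- s) dotp (F i) v.
Proof.
rewrite /dotp exchange_big/=; apply: eq_bigr => i _.
by rewrite summxE mulr_suml.
Qed.

Lemma sqnorm_ge0 u : 0 <= sqnorm u.
Proof. by apply: sumr_ge0 => i _; exact: sqr_ge0. Qed.

Lemma sqnormDZ u v t :
  sqnorm (u + t *: v) = sqnorm u + 2 * t * dotp u v + t ^+ 2 * sqnorm v.
Proof.
rewrite /sqnorm /dotp !mulr_sumr -!big_split/=.
by apply: eq_bigr => i _; rewrite !mxE; ring.
Qed.

Lemma normr_coord_le u i : `|u 0 i| <= `|u|.
Proof.
rewrite [leRHS]/Num.Def.normr/= mx_normrE.
exact: (le_bigmax _ (fun ij => `|u ij.1 ij.2|) (0, i)).
Qed.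

Lemma normr_le_coord u (b : R) :
  0 <= b -> (forall i, `|u 0 i| <= b) -> `|u| <= b.
Proof.
move=> b0 ub; rewrite /Num.Def.normr/= mx_normrE.
by apply: bigmax_le => // -[i j] _ /=; rewrite ord1.
Qed.

Lemma sqnorm_le_normr u : sqnorm u <= N%:R * `|u| ^+ 2.
Proof.
apply: sum_ord_le_const => i.
by rewrite -real_normK ?num_real// ler_sqr ?nnegrE// normr_coord_le.
Qed.

Lemma sqr_coord_le_sqnorm u i : u 0 i ^+ 2 <= sqnorm u.
Proof.
by rewrite /sqnorm (bigD1 i)//= lerDl; apply: sumr_ge0 => j _; exact: sqr_ge0.
Qed.

Lemma normr_le_sqrt_sqnorm u : `|u| <= Num.sqrt (sqnorm u).
Proof.
apply: normr_le_coord => [|i]; first exact: sqrtr_ge0.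
by rewrite -sqrtr_sqr ler_wsqrtr// sqr_coord_le_sqnorm.
Qed.

Lemma normr_dotp_le u v : `|dotp u v| <= N%:R * (`|u| * `|v|).
Proof.
apply: le_trans (ler_norm_sum _ _ _) _; apply: sum_ord_le_const => i.
by rewrite normrM ler_pM// normr_coord_le.
Qed.

Lemma dotp_ge u v : - (N%:R * (`|u| * `|v|)) <= dotp u v.
Proof. by have := normr_dotp_le u v; rewrite ler_norml => /andP[]. Qed.

End euclidean.

Lemma lipschitz_continuous (R : realFieldType) (V W : normedModType R)
    (f : V -> W) (k : R) :
  k.-lipschitz f -> continuous f.
Proof.
move=> flip x; apply/cvgrPdist_lt => e e0.
have r0 : 0 < e / (`|k| + 1) by rewrite divr_gt0// ltr_wpDl.
near=> y.
apply: le_lt_trans (flip (x, y) (conj I I)) _ => /=.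
have xy : `|x - y| < e / (`|k| + 1).
  by near: y; apply: (@cvgr_dist_lt _ _ _ _ _ id).
have nxy := normr_ge0 (x - y); have kle := ler_norm k.
by move: xy; rewrite ltr_pdivlMr ?ltr_wpDl//; nra.
Unshelve. all: by end_near. Qed.

Lemma lipschitz_comp (R : realFieldType) (U V W : normedModType R)
    (A : set V) (f : U -> V) (g : V -> W) (k l : R) :
  0 <= l -> (forall x, A (f x)) -> k.-lipschitz f -> l.-lipschitz_A g ->
  (l * k).-lipschitz (g \o f).
Proof.
move=> l0 Af flip glip [x y] _ /=.
apply: le_trans (glip (f x, f y) (conj (Af x) (Af y))) _ => /=.
by rewrite -mulrA ler_wpM2l// (flip (x, y) (conj I I)).
Qed.

Section average.
Context (R : realFieldType) (V : lmodType R).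

Definition average (J : nat) (x : 'I_J -> V) : V := J%:R^-1 *: \sum_n x n.

Lemma averageS (J : nat) (x : nat -> V) :
  let t := J.+1%:R / J.+2%:R in
  average (fun n : 'I_J.+2 => x n) =
  t *: average (fun n : 'I_J.+1 => x n) + (1 - t) *: x J.+1.
Proof.
rewrite /average big_ord_recr/= scalerDr scalerA; congr (_ *: _ + _ *: _).
  by rewrite mulrAC mulfV ?mul1r// pnatr_eq0.
rewrite -[X in X - _](@divff _ J.+2%:R) ?pnatr_eq0// -mulrBl.
by rewrite -natrB// subSnn mul1r.
Qed.

Lemma average_weight_itv (J : nat) : 0 <= (J.+1%:R / J.+2%:R : R) <= 1.
Proof. by rewrite divr_ge0//= ler_pdivrMr// mul1r ler_nat. Qed.

Lemma average_cst (J : nat) (v : V) :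
  (0 < J)%N -> average (fun _ : 'I_J => v) = v.
Proof.
move=> J0; rewrite /average sumr_const card_ord -[v *+ J]scaler_nat scalerA.
by rewrite mulVf ?scale1r// pnatr_eq0 -lt0n.
Qed.

End average.

Lemma normr_average_le (R : realFieldType) (V : normedModType R) (J : nat)
    (x : 'I_J -> V) (b : R) :
  (0 < J)%N -> (forall n, `|x n| <= b) -> `|average x| <= b.
Proof.
move=> J0 xb; rewrite /average normrZ ger0_norm ?invr_ge0//.
rewrite ler_pdivrMl ?ltr0n// (le_trans (ler_norm_sum _ _ _))//.
exact: sum_ord_le_const.
Qed.

Section convexity.
Context (R : realType) (N : nat) (A : set 'rV[R]_N).

Lemma convex_setP : convex_set A <->
  forall x y t, 0 <= t <= 1 -> A x -> A y -> A (t *: x + (1 - t) *: y).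
Proof.
split=> [cA x y t /andP[t0 t1] Ax Ay|cA x y t /set_mem Ax /set_mem Ay].
  exact: set_mem (cA x y (Itv01 t0 t1) (mem_set Ax) (mem_set Ay)).
by apply: mem_set; apply: cA => //; rewrite ge0 le1.
Qed.

Lemma convex_functionP (h : 'rV[R]_N -> R) : convex_function A h <->
  forall x y t, 0 <= t <= 1 -> A x -> A y ->
    h (t *: x + (1 - t) *: y) <= t * h x + (1 - t) * h y.
Proof.
split=> [ch x y t /andP[t0 t1] Ax Ay|ch t x y /set_mem Ax /set_mem Ay].
  exact: (ch (Itv01 t0 t1) x y (mem_set Ax) (mem_set Ay)).
by apply: ch => //; rewrite ge0 le1.
Qed.

Lemma convex_set_average (J : nat) (x : nat -> 'rV[R]_N) :
  convex_set A -> (forall n, A (x n)) -> A (average (fun n : 'I_J.+1 => x n)).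
Proof.
move=> /convex_setP cA Ax; elim: J => [|J IH].
  by rewrite /average big_ord1 invr1 scale1r.
by rewrite averageS; apply: cA => //; exact: average_weight_itv.
Qed.

Lemma convex_function_average (h : 'rV[R]_N -> R) (J : nat)
    (x : nat -> 'rV[R]_N) :
  convex_set A -> convex_function A h -> (forall n, A (x n)) ->
  h (average (fun n : 'I_J.+1 => x n)) <= average (fun n : 'I_J.+1 => h (x n)).
Proof.
move=> cA /convex_functionP ch Ax; elim: J => [|J IH].
  by rewrite /average !big_ord1 invr1 !scale1r.
rewrite (averageS J (fun n => h (x n))) averageS.
apply: le_trans (ch _ _ _ (average_weight_itv R J) _ _) _ => //.
  exact: convex_set_average.
by rewrite lerD2r ler_wpM2l.
Qed.

Definition subgradient_on (h : 'rV[R]_N -> R) (g : 'rV[R]_N -> 'rV[R]_N) :=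
  forall x y, A x -> A y -> h x + dotp (g x) (y - x) <= h y.

Lemma subgradient_convex h g :
  convex_set A -> subgradient_on h g -> convex_function A h.
Proof.
move=> /convex_setP cA hg; apply/convex_functionP => x y t t01 Ax Ay.
have [Az /andP[t0 t1]] := (cA _ _ _ t01 Ax Ay, t01).
set z := _ + _ in Az *.
have := hg z x Az Ax; have := hg z y Az Ay.
have -> : y - z = (- t) *: (x - y) by apply/rowP => i; rewrite !mxE; ring.
have -> : x - z = (1 - t) *: (x - y) by apply/rowP => i; rewrite !mxE; ring.
rewrite !dotpZr; nra.
Qed.

Lemma subgradient_lipschitz h g (G : R) : subgradient_on h g ->
  (forall x, A x -> `|g x| <= G) -> (N%:R * G).-lipschitz_A h.
Proof.
move=> hg gG [x y] [/= Ax Ay].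
suff upper u v : A u -> A v -> h u - h v <= N%:R * G * `|u - v|.
  by rewrite ler_norml upper// lerNl opprB distrC upper.
move=> Au Av; have := hg u v Au Av; have := dotp_ge (g u) (v - u).
rewrite distrC.
have : `|g u| * `|u - v| <= G * `|u - v| by rewrite ler_wpM2r ?gG.
rewrite -mulrA; have := ler0n R N; nra.
Qed.

End convexity.

Definition is_projection (R : realType) (N : nat) (A : set 'rV[R]_N)
    (proj : 'rV[R]_N -> 'rV[R]_N) : Prop :=
  forall x, A (proj x) /\
    (forall z, A z -> sqnorm (proj x - x) <= sqnorm (z - x)).

Section projection.
Context (R : realType) (N : nat) (A : set 'rV[R]_N).
Variable proj : 'rV[R]_N -> 'rV[R]_N.
Hypothesis convexA : convex_set A.
Hypothesis projA : is_projection A proj.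
Implicit Types x y z : 'rV[R]_N.

Lemma projection_in x : A (proj x).
Proof. exact: (projA x).1. Qed.

Lemma projection_id x : A x -> proj x = x.
Proof.
move=> Ax; have := (projA x).2 _ Ax.
rewrite subrr {2}/sqnorm big1 => [proj0|i _]; last by rewrite mxE expr0n.
apply/eqP; rewrite -subr_eq0 -normr_le0.
by rewrite (le_trans (normr_le_sqrt_sqnorm _))// ler0_sqrtr.
Qed.

Lemma projection_variational x z : A z -> 0 <= dotp (proj x - x) (z - proj x).
Proof.
move=> Az; set a := dotp _ _; set b := sqnorm (z - proj x).
have b0 : 0 <= b by exact: sqnorm_ge0.
have segment t : 0 < t -> t <= 1 -> 0 <= 2 * a + t * b.
  move=> t0 t1.
  have At : A (t *: z + (1 - t) *: proj x).
    move/convex_setP: convexA; apply=> //; first by rewrite ltW.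
    exact: projection_in.
  have := (projA x).2 _ At.
  have -> : t *: z + (1 - t) *: proj x - x = (proj x - x) + t *: (z - proj x).
    by apply/rowP => i; rewrite !mxE; ring.
  by rewrite sqnormDZ -/a -/b -(pmulr_rge0 _ t0); lra.
rewrite leNgt; apply/negP => a0.
have ba : 0 < b - a by lra.
have t0 : 0 < - a / (b - a) by rewrite divr_gt0// oppr_gt0.
have t1 : - a / (b - a) <= 1 by rewrite ler_pdivrMr//; lra.
have := segment _ t0 t1.
have -> : - a / (b - a) * b = - a * (b / (b - a)) by ring.
have : b / (b - a) <= 1 by rewrite ler_pdivrMr//; lra.
nra.
Qed.

Lemma projection_nonexpansive x y : sqnorm (proj x - proj y) <= sqnorm (x - y).
Proof.
have := projection_variational x (projection_in y).
have := projection_variational y (projection_in x).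
set u := proj x - proj y.
have variational_sum :
    dotp (proj x - x) (proj y - proj x) + dotp (proj y - y) (proj x - proj y) =
    dotp (x - y) u - sqnorm u.
  rewrite /dotp /sqnorm -sumrN -!big_split/=.
  by apply: eq_bigr => i _; rewrite !mxE; ring.
have := sqnorm_ge0 (x - y + (-1) *: u); rewrite sqnormDZ; lra.
Qed.

Lemma projection_lipschitz : (Num.sqrt N%:R).-lipschitz proj.
Proof.
move=> [x y] _ /=; apply: le_trans (normr_le_sqrt_sqnorm _) _.
rewrite -[X in _ * X]ger0_norm// -sqrtr_sqr -sqrtrM ?ler0n// ler_wsqrtr//.
exact: le_trans (projection_nonexpansive _ _) (sqnorm_le_normr _).
Qed.

Lemma projection_continuous : continuous proj.
Proof. exact: lipschitz_continuous projection_lipschitz. Qed.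

Lemma projection_step_sqnorm x z g (t : R) : A z ->
  sqnorm (proj (x - t *: g) - z) <=
  sqnorm (x - z) - 2 * t * dotp g (x - z) + t ^+ 2 * sqnorm g.
Proof.
move=> Az; rewrite -{1}(projection_id Az).
apply: le_trans (projection_nonexpansive _ _) _.
have -> : x - t *: g - z = (x - z) + (- t) *: g.
  by apply/rowP => i; rewrite !mxE; ring.
by rewrite sqnormDZ sqrrN (dotpC (x - z)) mulrN mulNr.
Qed.

End projection.

(* [sqrt J * d J] is a potential that turns the sum weighted by [sqrt] into a
   telescoping one; the squared steps are summed through
   [1 / sqrt J.+1 <= 2 * (sqrt J.+1 - sqrt J)]. *)
Lemma descent_sum_le_sqrt (R : realType) (a G D : R) (s d : nat -> R) :
  0 < a -> 0 <= G ->
  (forall n, 0 <= d n <= D) ->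
  (forall n, 2 * (a / Num.sqrt n.+1%:R) * s n <=
     d n - d n.+1 + (a / Num.sqrt n.+1%:R) ^+ 2 * G) ->
  forall J, \sum_(n < J) s n <= (D / (2 * a) + a * G) * Num.sqrt J%:R.
Proof.
move=> a0 G0 dD descent J.
suff potential : 2 * a * \sum_(n < J) s n + Num.sqrt J%:R * d J <=
    (D + 2 * a ^+ 2 * G) * Num.sqrt J%:R.
  have -> : (D / (2 * a) + a * G) * Num.sqrt J%:R =
      (D + 2 * a ^+ 2 * G) * Num.sqrt J%:R / (2 * a) by field; rewrite gt_eqF.
  rewrite ler_pdivlMr ?mulr_gt0// mulrC.
  apply: le_trans potential; rewrite lerDl mulr_ge0 ?sqrtr_ge0//.
  by case/andP: (dD J).
elim: J => [|J IH]; first by rewrite big_ord0 sqrtr0 mul0r !mulr0 addr0.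
rewrite big_ord_recr/=; have {descent} := descent J.
set q := Num.sqrt J.+1%:R; set q' := Num.sqrt J%:R in IH * => descent.
have q_gt0 : 0 < q by rewrite sqrtr_gt0 ltr0n.
have q'_ge0 : 0 <= q' by exact: sqrtr_ge0.
have q_sqr : q ^+ 2 = q' ^+ 2 + 1 by rewrite !sqr_sqrtr ?ler0n// -natr1.
have q'_le_q : q' <= q by rewrite ler_wsqrtr// ler_nat.
have scaled_descent : 2 * a * s J <= q * (d J - d J.+1) + a ^+ 2 * G / q.
  rewrite -(ler_pM2l q_gt0) in descent; move: descent; congr (_ <= _);
    field; rewrite gt_eqF//.
have invq_le : q^-1 <= 2 * (q - q') by rewrite -[_^-1]mul1r ler_pdivrMr//; nra.
have noise : a ^+ 2 * G / q <= a ^+ 2 * G * (2 * (q - q')).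
  by rewrite ler_wpM2l// mulr_ge0// sqr_ge0.
have drift : (q - q') * d J <= (q - q') * D.
  by rewrite ler_wpM2l ?subr_ge0//; case/andP: (dD J).
nra.
Qed.

Definition regret_rate (R : realType) (N : nat) (D G b : R) : R :=
  N%:R * G * ((2 * D) ^+ 2 / (2 * b) + b).

Lemma projected_subgradient_regret (R : realType) (N : nat) (A : set 'rV[R]_N)
    (proj : 'rV[R]_N -> 'rV[R]_N) (D G b : R) (x g : nat -> 'rV[R]_N) :
  convex_set A -> is_projection A proj -> (forall y, A y -> `|y| <= D) ->
  0 < b -> (forall n, A (x n)) -> (forall n, `|g n| <= G) ->
  (forall n, x n.+1 = proj (x n - (b / (G * Num.sqrt n.+1%:R)) *: g n)) ->
  forall z, A z -> forall J,
    \sum_(n < J) dotp (g n) (x n - z) <= regret_rate N D G b * Num.sqrt J%:R.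
Proof.
move=> cA projA AD b0 Ax gG xS z Az J; rewrite /regret_rate.
have : 0 <= G by exact: le_trans (gG 0%N).
rewrite le_eqVlt => /predU1P[G0|G0].
  rewrite -G0 mulr0 !mul0r big1// => n _.
  have -> : g n = 0 by apply/eqP; rewrite -normr_le0 G0.
  by rewrite /dotp big1// => i _; rewrite mxE mul0r.
have -> : N%:R * G * ((2 * D) ^+ 2 / (2 * b) + b) =
    N%:R * (2 * D) ^+ 2 / (2 * (b / G)) + b / G * (N%:R * G ^+ 2).
  by field; rewrite !gt_eqF.
apply: (descent_sum_le_sqrt (s := fun n => dotp (g n) (x n - z))
    (d := fun n => sqnorm (x n - z))).
- by rewrite divr_gt0.
- by rewrite mulr_ge0// sqr_ge0.
- move=> n; rewrite sqnorm_ge0/= (le_trans (sqnorm_le_normr _))// ler_wpM2l//.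
  have := AD z Az; have := AD (x n) (Ax n); have := ler_normB (x n) z.
  have := normr_ge0 (x n - z); nra.
- move=> n.
  have -> : b / G / Num.sqrt n.+1%:R = b / (G * Num.sqrt n.+1%:R).
    by rewrite invfM mulrA.
  set t := b / (G * _).
  have := projection_step_sqnorm cA projA (x n) (g n) t Az; rewrite -xS.
  have : t ^+ 2 * sqnorm (g n) <= t ^+ 2 * (N%:R * G ^+ 2).
    rewrite ler_wpM2l ?sqr_ge0// (le_trans (sqnorm_le_normr _))// ler_wpM2l//.
    by rewrite ler_sqr ?nnegrE ?(ltW G0)//.
  lra.
Qed.

(** * Measurability and independence *)

Lemma measurable_preimage (d d' : measure_display) (T : measurableType d)
    (U : measurableType d') (f : T -> U) (B : set U) :
  measurable_fun setT f -> measurable B -> measurable (f @^-1` B).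
Proof. by move=> mf mB; rewrite -[X in measurable X]setTI; exact: mf. Qed.

Section measurable_vectors.
Context (d : measure_display) (T : measurableType d) (R : realType) (N : nat).

Definition row_tuple (x : 'rV[R]_N) : N.-tuple R := [tuple x 0 i | i < N].

Lemma row_tupleK : cancel row_tuple (@tvec R N).
Proof. by move=> x; apply/rowP => i; rewrite mxE tnth_mktuple. Qed.

Definition measurable_coords (Y : T -> 'rV[R]_N) : Prop :=
  forall i, measurable_fun setT (fun w => Y w 0 i).

Lemma measurable_row_tuple (Y : T -> 'rV[R]_N) :
  measurable_coords Y -> measurable_fun setT (fun w => row_tuple (Y w)).
Proof.
move=> mY; apply/measurable_fun_tnthP => i.
rewrite (_ : _ \o _ = fun w => Y w 0 i)//.
by apply/funext => w; exact: tnth_mktuple.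
Qed.

Lemma measurable_tnth_comp (E : T -> N.-tuple R) i :
  measurable_fun setT E -> measurable_fun setT (fun w => tnth (E w) i).
Proof. by move=> /measurable_fun_tnthP/(_ i). Qed.

Lemma rat_rV_approx (x : 'rV[R]_N) (e : R) : 0 < e ->
  exists q : 'rV[rat]_N, `|x - map_mx ratr q| <= e.
Proof.
move=> e0; have coord_approx i : exists q : rat, `|x 0 i - ratr q| <= e.
  have /rat_in_itvoo[q] : x 0 i - e < x 0 i + e by lra.
  rewrite in_itv/= => /andP[? ?]; exists q; rewrite ler_norml.
  by apply/andP; split; lra.
have [q qe] := choice coord_approx.
by exists (\row_i q i); apply: normr_le_coord (ltW e0) _ => i; rewrite !mxE.
Qed.

Lemma open_bigcup_rat_closed_ball (U : set 'rV[R]_N) : open U ->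
  exists I : set ('rV[rat]_N * nat),
    U = \bigcup_(z in I) [set x | `|x - map_mx ratr z.1| <= z.2.+1%:R^-1].
Proof.
pose ball_ (z : 'rV[rat]_N * nat) := [set x : 'rV[R]_N |
  `|x - map_mx ratr z.1| <= z.2.+1%:R^-1].
move=> oU; exists [set z | ball_ z `<=` U].
apply/seteqP; split=> [x Ux|x [z zU]]; last exact: zU.
have /nbhs_ballP[e /= e0 xeU] : nbhs x U by exact: open_nbhs_nbhs.
have [|n] := @ltr_add_invr R 0 (e / 2); first by rewrite divr_gt0.
rewrite add0r => ne; have [|q xq] := @rat_rV_approx x n.+1%:R^-1; first by [].
exists (q, n) => // y /= yq; apply: xeU; rewrite -ball_normE /ball_/=.
have := ler_distD (map_mx ratr q) x y.
rewrite [X in _ <= _ + X]distrC => /le_lt_trans; apply.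
by rewrite (le_lt_trans (lerD xq yq))// (splitr e) ltrD.
Qed.

Lemma measurable_normr_coords (Y : T -> 'rV[R]_N) :
  measurable_coords Y -> measurable_fun setT (fun w => `|Y w|).
Proof.
move=> mY; under eq_fun do rewrite /Num.Def.normr/= mx_normrE.
elim: (index_enum _) => [|[i j] s IH].
  by under eq_fun do rewrite big_nil; exact: measurable_cst.
rewrite (ord1 i); under eq_fun do rewrite big_cons.
by apply: measurable_maxr => //; exact: measurableT_comp.
Qed.

Lemma measurable_continuous_coords (h : 'rV[R]_N -> R) (Y : T -> 'rV[R]_N) :
  continuous h -> measurable_coords Y -> measurable_fun setT (fun w => h (Y w)).
Proof.
move=> /continuousP hc mY; apply: (measurability _ (RGenOpens.measurableE R)).
move=> _ [_ [a [b ->]] <-]; rewrite setTI.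
have oab := @interval_open _ (BRight a) (BLeft b) isT isT.
have [I /= hI] := open_bigcup_rat_closed_ball (hc _ oab).
rewrite -[X in measurable X]/(Y @^-1` (h @^-1` _)) hI.
rewrite preimage_bigcup bigcup_mkcond.
apply: countable_bigcupT_measurable => [|z]; first exact: countableP.
case: ifP => // _.
have mdist : measurable_fun setT (fun w => `|Y w - map_mx ratr z.1|).
  apply: measurable_normr_coords => i.
  by under eq_fun do rewrite !mxE; exact: measurable_funB.
have := measurable_preimage mdist (measurable_itv `]-oo, z.2.+1%:R^-1]).
by rewrite set_itvE.
Qed.

End measurable_vectors.

Section independence.
Context (R : realType) (d d' : measure_display) (Omega : measurableType d)
  (T : measurableType d') (I : eqType) (P : probability Omega R)
  (X : I -> Omega -> T).

Definition cylinders (Q : pred I) : set (set Omega) :=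
  [set E | exists (S : seq I) (B : I -> set T),
    [/\ uniq S, all Q S, forall i, measurable (B i) &
        E = \bigcap_(i in [set` S]) (X i @^-1` B i)]].

Lemma cylinders_setT (Q : pred I) : cylinders Q setT.
Proof.
by exists [::], (fun=> setT); rewrite classical_sets.set_nil bigcap_set0.
Qed.

Lemma cylinders_setI (Q : pred I) : setI_closed (cylinders Q).
Proof.
move=> _ _ [S1 [B1 [u1 Q1 m1 ->]]] [S2 [B2 [u2 Q2 m2 ->]]].
exists (undup (S1 ++ S2)), (fun i => (if i \in S1 then B1 i else setT) `&`
  (if i \in S2 then B2 i else setT)); split.
- exact: undup_uniq.
- by apply/allP => i; rewrite mem_undup mem_cat => /orP[/(allP Q1)|/(allP Q2)].
- by move=> i; apply: measurableI; case: ifP.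
- apply/seteqP; split=> w /=.
    by move=> [w1 w2] i _ /=; split; case: ifP => // iS; [exact: w1|exact: w2].
  by move=> ww; split=> i /= iS; have := ww i;
    rewrite /= mem_undup mem_cat iS ?orbT => /(_ isT)[].
Qed.

Lemma measurable_fun_cylinders (Q : pred I) i : Q i ->
  measurable_fun setT (X i : g_sigma_algebraType (cylinders Q) -> T).
Proof.
move=> Qi _ B mB; rewrite setTI; apply: sub_gen_smallest.
exists [:: i], (fun=> B); split => //=; first by rewrite Qi.
apply/seteqP; split=> w /=; first by move=> XB j /=; rewrite inE => /eqP ->.
by apply; rewrite /= inE.
Qed.

Hypothesis mX : forall i, measurable_fun setT (X i).
Hypothesis indX : mutually_independent P X.

Lemma cylinders_measurable (Q : pred I) : cylinders Q `<=` measurable.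
Proof.
move=> _ [S [B [_ _ mB ->]]]; apply: fin_bigcap_measurable => // i _.
exact: measurable_preimage.
Qed.

Lemma independent_cylinder (Q : pred I) i (A : set T) (E : set Omega) :
  ~~ Q i -> measurable A -> cylinders Q E ->
  P (E `&` X i @^-1` A) = (P (X i @^-1` A) * P E)%E.
Proof.
move=> Qi mA [S [B [uS QS mB ->]]].
have iS : i \notin S by apply: contra Qi => /(allP QS).
pose B' j := if j == i then A else B j.
have mB' j : measurable (B' j) by rewrite /B'; case: ifP.
have -> : \bigcap_(j in [set` S]) X j @^-1` B j =
    \bigcap_(j in [set` S]) X j @^-1` B' j.
  apply: eq_bigcapr => j /= jS; rewrite /B'; case: eqP => // ji.
  by rewrite ji (negbTE iS) in jS.
rewrite (indX uS)//.
transitivity (P (\bigcap_(j in [set` i :: S]) X j @^-1` B' j)).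
  have -> : [set` i :: S] = i |` [set` S].
    by apply/seteqP; split=> j /=; rewrite inE => /predU1P.
  by rewrite bigcap_setU1 setIC {2}/B' eqxx.
by rewrite indX//= ?iS// big_cons /B' eqxx.
Qed.

Lemma independent_g_sigma_cylinders (Q : pred I) i (A : set T) (E : set Omega) :
  ~~ Q i -> measurable A -> <<s cylinders Q >> E ->
  P (X i @^-1` A `&` E) = (P (X i @^-1` A) * P E)%E.
Proof.
move=> Qi mA sE.
have mF : measurable (X i @^-1` A) by exact: measurable_preimage.
have PF0 : 0 <= fine (P (X i @^-1` A)) by exact: fine_ge0.
have PFE : (fine (P (X i @^-1` A)))%:E = P (X i @^-1` A).
  by rewrite fineK// fin_num_measure.
rewrite -PFE setIC.
apply: (@g_sigma_algebra_measure_unique _ _ _ (cylinders Q) _ (fun=> setT) _ _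
  (mrestr P mF) (mscale (NngNum PF0) P)) => //.
- exact: cylinders_measurable.
- by move=> _; exact: cylinders_setT.
- by rewrite bigcup_const.
- exact: cylinders_setI.
- by move=> D cD; rewrite [LHS](independent_cylinder Qi mA cD) -[in LHS]PFE.
- by move=> _; rewrite /mrestr /= ltey_eq fin_num_measure//; exact: measurableI.
Qed.

End independence.

(* [integral_pushforward] asks for integrability, which Fubini's theorem gives
   for almost all sections only. *)
Lemma integral_pushforwardT (R : realType) (d1 d2 : measure_display)
    (T1 : measurableType d1) (T2 : measurableType d2)
    (mu : {measure set T1 -> \bar R}) (phi : T1 -> T2) (f : T2 -> \bar R) :
  measurable_fun setT phi -> measurable_fun setT f ->
  (\int[pushforward mu phi]_y f y = \int[mu]_x f (phi x))%E.
Proof.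
move=> mphi mf; rewrite [LHS]integralE [RHS]integralE; congr (_ - _)%E.
- by rewrite ge0_integral_pushforward ?preimage_setT -?funepos_comp//;
    exact: measurable_funepos.
- by rewrite ge0_integral_pushforward ?preimage_setT -?funeneg_comp//;
    exact: measurable_funeneg.
Qed.

Lemma eq_law_integral (R : realType) (d d' : measure_display)
    (Omega : measurableType d) (T : measurableType d')
    (mu : {measure set Omega -> \bar R}) (X Y : Omega -> T) (g : T -> \bar R) :
  measurable_fun setT X -> measurable_fun setT Y ->
  (forall B, measurable B -> mu (X @^-1` B) = mu (Y @^-1` B)) ->
  measurable_fun setT g ->
  (\int[mu]_w g (X w) = \int[mu]_w g (Y w))%E.
Proof.
move=> mX mY XY mg.
rewrite -(integral_pushforwardT mu mX mg) -(integral_pushforwardT mu mY mg).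
by apply: eq_measure_integral => B mB _; exact: XY.
Qed.

Lemma independent_integral (R : realType) (d d1 d2 : measure_display)
    (Omega : measurableType d) (T1 : measurableType d1) (T2 : measurableType d2)
    (P : probability Omega R) (X : Omega -> T1) (Y : Omega -> T2)
    (phi : T1 * T2 -> \bar R) :
  measurable_fun setT X -> measurable_fun setT Y ->
  (forall A B, measurable A -> measurable B ->
    P (X @^-1` A `&` Y @^-1` B) = (P (X @^-1` A) * P (Y @^-1` B))%E) ->
  measurable_fun setT phi -> P.-integrable setT (fun w => phi (X w, Y w)) ->
  (\int[P]_w phi (X w, Y w) = \int[P]_w \int[P]_w' phi (X w', Y w))%E.
Proof.
move=> mX mY ind mphi iphi.
pose XM := isMeasurableFun.Build _ _ _ _ _ mX.
pose X' : {mfun Omega >-> T1} := HB.pack X XM.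
pose YM := isMeasurableFun.Build _ _ _ _ _ mY.
pose Y' : {mfun Omega >-> T2} := HB.pack Y YM.
have mXY : measurable_fun setT (fun w => (X w, Y w)).
  exact: measurable_fun_pair.
pose XYM := isMeasurableFun.Build _ _ _ _ _ mXY.
pose XY' : {mfun Omega >-> (T1 * T2)%type} := HB.pack (fun w => (X w, Y w)) XYM.
have joint_law A : measurable A ->
    distribution P XY' A = (distribution P X' \x distribution P Y')%E A.
  by move=> mA; apply/esym/product_measure_unique => // B C ? ?; exact: ind.
have iprod : (distribution P X' \x distribution P Y')%E.-integrable setT phi.
  have /integrableP[_] := integrable_pushforward mXY mphi iphi measurableT.
  rewrite (eq_measure_integral _ (fun A mA _ => joint_law A mA)) => phi_lty.
  by apply/integrableP; split.
transitivity (\int[distribution P XY']_z phi z)%E.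
  by rewrite integral_pushforwardT.
rewrite (eq_measure_integral _ (fun A mA _ => joint_law A mA)).
rewrite -integral21_prod_meas1// integral_pushforwardT//; last first.
  exact: (measurable_fubini_G iprod).
apply: eq_integral => w _; rewrite /fubini_G integral_pushforwardT//.
by apply: measurableT_comp => //; exact: measurable_fun_pair.
Qed.

Section finite_sums.
Context (R : realType) (d : measure_display) (T : measurableType d)
  (mu : {measure set T -> \bar R}) (D : set T).
Hypothesis mD : measurable D.

Lemma integrable_sumr (I : Type) (s : seq I) (h : I -> T -> R) :
  (forall i, mu.-integrable D (EFin \o h i)) ->
  mu.-integrable D (EFin \o (fun w => \sum_(i <- s) h i w)).
Proof.
move=> ih; have := integrable_sum mD s (P := xpredT) (fun i _ => ih i).
by apply: eq_integrable => // w _ /=; rewrite sumEFin.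
Qed.

Lemma Rintegral_sum (I : Type) (s : seq I) (h : I -> T -> R) :
  (forall i, mu.-integrable D (EFin \o h i)) ->
  \int[mu]_(w in D) (\sum_(i <- s) h i w) =
  \sum_(i <- s) \int[mu]_(w in D) h i w.
Proof.
move=> ih; elim: s => [|i s IH].
  under eq_Rintegral do rewrite big_nil.
  by rewrite Rintegral_cst// mul0r big_nil.
under eq_Rintegral do rewrite big_cons.
by rewrite RintegralD// ?IH ?big_cons//; exact: integrable_sumr.
Qed.

Lemma integrable_average (J : nat) (h : 'I_J -> T -> R) :
  (forall n, mu.-integrable D (EFin \o h n)) ->
  mu.-integrable D (EFin \o (fun w => average (fun n => h n w))).
Proof.
move=> ih.
by apply: (integrableZl mD J%:R^-1 (integrable_sumr _ _)) => n; exact: ih.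
Qed.

Lemma Rintegral_average (J : nat) (h : 'I_J -> T -> R) :
  (forall n, mu.-integrable D (EFin \o h n)) ->
  \int[mu]_(w in D) average (fun n => h n w) =
  average (fun n => \int[mu]_(w in D) h n w).
Proof.
move=> ih; rewrite /average RintegralZl//; last first.
  by apply: integrable_sumr => n; exact: ih.
by rewrite Rintegral_sum// => n; exact: ih.
Qed.

End finite_sums.

Section probability_Rintegral.
Context (R : realType) (d : measure_display) (Omega : measurableType d)
  (P : probability Omega R).

Lemma bounded_integrable (g : Omega -> R) (b : R) :
  measurable_fun setT g -> (forall w, `|g w| <= b) ->
  P.-integrable setT (EFin \o g).
Proof.
move=> mg gb; apply: measurable_bounded_integrable => //.
  by rewrite ltey_eq fin_num_measure.
exists b; split; first exact: num_real.
by move=> y b_lt_y w _ /=; rewrite (le_trans (gb w))// ltW.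
Qed.

Lemma probability_Rintegral_cst (k : R) : \int[P]_w k = k.
Proof. by rewrite Rintegral_cst// [X in fine X]probability_setT mulr1. Qed.

Lemma Rintegral_le_cst (g : Omega -> R) (k : R) :
  P.-integrable setT (EFin \o g) -> (forall w, g w <= k) -> \int[P]_w g w <= k.
Proof.
move=> ig gk; rewrite -[leRHS]probability_Rintegral_cst.
by apply: le_Rintegral => //; exact: finite_measure_integrable_cst.
Qed.

Lemma cst_le_Rintegral (g : Omega -> R) (k : R) :
  P.-integrable setT (EFin \o g) -> (forall w, k <= g w) -> k <= \int[P]_w g w.
Proof.
move=> ig gk; rewrite -[leLHS]probability_Rintegral_cst.
by apply: le_Rintegral => //; exact: finite_measure_integrable_cst.
Qed.

Lemma normr_Rintegral_le (g : Omega -> R) (b : R) :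
  P.-integrable setT (EFin \o g) -> (forall w, `|g w| <= b) ->
  `|\int[P]_w g w| <= b.
Proof.
move=> ig gb; apply: le_trans (le_normr_Rintegral _ ig) _ => //.
by apply: Rintegral_le_cst => //; exact: integrable_abse ig.
Qed.

End probability_Rintegral.

(** * Projected stochastic subgradient descent *)

Section sgd.
Context (R : realType) (N M : nat) (S : Type) (proj : 'rV[R]_N -> 'rV[R]_N)
  (step : nat -> R) (slope : S -> 'rV[R]_N -> 'rV[R]_N) (x1 : 'rV[R]_N).

Definition batch_slope (batch : 'I_M -> S) (x : 'rV[R]_N) : 'rV[R]_N :=
  average (fun m => slope (batch m) x).

Fixpoint sgd (batches : nat -> 'I_M -> S) (n : nat) : 'rV[R]_N :=
  if n is n'.+1 then
    let x := sgd batches n' in proj (x - step n' *: batch_slope (batches n') x)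
  else x1.

Lemma sgd_in (A : set 'rV[R]_N) batches n :
  (forall x, A (proj x)) -> A x1 -> A (sgd batches n).
Proof. by case: n => [|n] Aproj Ax1 //=; exact: Aproj. Qed.

End sgd.

Lemma eq_sgd (R : realType) (N M : nat) (S : Type) (proj : 'rV[R]_N -> 'rV[R]_N)
    (step step' : nat -> R) (slope slope' : S -> 'rV[R]_N -> 'rV[R]_N)
    (x1 : 'rV[R]_N) (batches : nat -> 'I_M -> S) :
  step =1 step' ->
  (forall n m, slope (batches n m) =1 slope' (batches n m)) ->
  sgd proj step slope x1 batches =1 sgd proj step' slope' x1 batches.
Proof.
move=> eq_step eq_slope; elim=> [//|n IH] /=.
rewrite IH eq_step /batch_slope /average.
congr (proj (_ - _ *: (_ *: _))); apply: eq_bigr => m _; exact: eq_slope.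
Qed.

Section joint_measurability.
Context (R : realType) (N : nat) (d' : measure_display) (S : measurableType d').

Definition jointly_measurable (h : S -> 'rV[R]_N -> R) : Prop :=
  measurable_fun setT (fun z : S * N.-tuple R => h z.1 (tvec z.2)).

Context (d : measure_display) (T : measurableType d).

Lemma jointly_measurable_comp h (E : T -> S) (Y : T -> 'rV[R]_N) :
  jointly_measurable h -> measurable_fun setT E -> measurable_coords Y ->
  measurable_fun setT (fun w => h (E w) (Y w)).
Proof.
move=> mh mE mY; under eq_fun do rewrite -[Y _]row_tupleK.
have mEY : measurable_fun setT (fun w => (E w, row_tuple (Y w))).
  by apply: measurable_fun_pair => //; exact: measurable_row_tuple.
exact: (measurableT_comp mh mEY).
Qed.

Lemma measurable_average (J : nat) (Y : 'I_J -> T -> 'rV[R]_N) :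
  (forall n, measurable_coords (Y n)) ->
  measurable_coords (fun w => average (Y^~ w)).
Proof.
move=> mY i; under eq_fun do rewrite mxE summxE.
by apply: measurable_funM => //; apply: measurable_sum => n; exact: mY.
Qed.

Lemma measurable_sgd (M : nat) (proj : 'rV[R]_N -> 'rV[R]_N) (step : nat -> R)
    (slope : S -> 'rV[R]_N -> 'rV[R]_N) (x1 : 'rV[R]_N)
    (X : nat -> 'I_M -> T -> S) (n : nat) :
  continuous proj ->
  (forall i, jointly_measurable (fun s x => slope s x 0 i)) ->
  (forall k m, (k < n)%N -> measurable_fun setT (X k m)) ->
  measurable_coords (fun w => sgd proj step slope x1 (fun k m => X k m w) n).
Proof.
move=> cproj mslope; elim: n => [_ i|n IH mX i] /=; first exact: measurable_cst.
have {}IH := IH (fun k m kn => mX k m (ltnW kn)).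
apply: (measurable_continuous_coords (h := fun x => proj x 0 i)) => [x|j].
  exact: (continuous_comp (cproj x) (@coord_continuous _ _ _ 0 i (proj x))).
under eq_fun do rewrite !mxE summxE.
apply: measurable_funB; first exact: IH.
apply: measurable_funM => //; apply: measurable_funM => //.
apply: measurable_sum => m.
by apply: (jointly_measurable_comp (mslope j)) => //; exact: mX.
Qed.

End joint_measurability.

Record subgradient_oracle (R : realType) (N : nat) (d : measure_display)
    (S : measurableType d) (A : set 'rV[R]_N) (L G : R)
    (loss : S -> 'rV[R]_N -> R) (slope : S -> 'rV[R]_N -> 'rV[R]_N) : Prop :=
  SubgradientOracle {
    oracle_subgradient : forall s, subgradient_on A (loss s) (slope s);
    oracle_loss_bounded : forall s x, A x -> `|loss s x| <= L;
    oracle_slope_bounded : forall s x, A x -> `|slope s x| <= G;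
    oracle_loss_measurable : jointly_measurable loss;
    oracle_slope_measurable :
      forall i, jointly_measurable (fun s x => slope s x 0 i) }.

Section sgd_convergence.
Context (R : realType) (d d' : measure_display) (Omega : measurableType d)
  (S : measurableType d') (P : probability Omega R) (N M : nat).
Variables (A : set 'rV[R]_N) (proj : 'rV[R]_N -> 'rV[R]_N) (D G L b : R).
Hypothesis convexA : convex_set A.
Hypothesis projA : is_projection A proj.
Hypothesis boundedA : forall x, A x -> `|x| <= D.

Variables (loss : S -> 'rV[R]_N -> R) (slope : S -> 'rV[R]_N -> 'rV[R]_N).
Hypothesis oracle : subgradient_oracle A L G loss slope.

Variable eps : Omega -> S.
Hypothesis meps : measurable_fun setT eps.

Definition risk (x : 'rV[R]_N) : R := \int[P]_w loss (eps w) x.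

Lemma loss_comp_integrable (E : Omega -> S) (Y : Omega -> 'rV[R]_N) :
  measurable_fun setT E -> measurable_coords Y -> (forall w, A (Y w)) ->
  P.-integrable setT (EFin \o (fun w => loss (E w) (Y w))).
Proof.
move=> mE mY AY; apply: (bounded_integrable P (b := L)).
  exact: jointly_measurable_comp (oracle_loss_measurable oracle) mE mY.
by move=> w; exact: (oracle_loss_bounded oracle).
Qed.

Lemma loss_integrable (E : Omega -> S) x :
  measurable_fun setT E -> A x ->
  P.-integrable setT (EFin \o (fun w => loss (E w) x)).
Proof. by move=> mE Ax; apply: (loss_comp_integrable (Y := fun=> x)). Qed.

Lemma risk_bounded x : A x -> `|risk x| <= L.
Proof.
move=> Ax; apply: normr_Rintegral_le; first exact: loss_integrable.
by move=> w; exact: (oracle_loss_bounded oracle).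
Qed.

Lemma risk_convex : convex_function A risk.
Proof.
apply/convex_functionP => x y t t01 Ax Ay.
have ix := loss_integrable meps Ax; have iy := loss_integrable meps Ay.
have itx := integrableZl measurableT t ix.
have ity := integrableZl measurableT (1 - t) iy.
rewrite /risk -!RintegralZl// -RintegralD//; apply: le_Rintegral => //.
- by apply: loss_integrable => //; move/convex_setP: convexA; exact.
- exact: (integrableD measurableT itx ity).
- move=> w _.
  have := subgradient_convex convexA (oracle_subgradient oracle (eps w)).
  by move=> /convex_functionP; exact.
Qed.

Lemma risk_lipschitz : (N%:R * G).-lipschitz_A risk.
Proof.
move=> [x y] [/= Ax Ay].
have ix := loss_integrable meps Ax; have iy := loss_integrable meps Ay.
have loss_dist w : `|loss (eps w) x - loss (eps w) y| <= N%:R * G * `|x - y|.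
  have loss_lip := subgradient_lipschitz (oracle_subgradient oracle (eps w))
    (oracle_slope_bounded oracle (eps w)).
  exact: (loss_lip (x, y) (conj Ax Ay)).
rewrite /risk -RintegralB//; apply: normr_Rintegral_le => //.
exact: (integrableB measurableT ix iy).
Qed.

Lemma risk_proj_continuous : continuous (risk \o proj).
Proof.
have G0 : 0 <= G.
  apply: le_trans (normr_ge0 _) _.
  exact: (oracle_slope_bounded oracle point (projection_in projA 0)).
have := lipschitz_comp _ (projection_in projA)
  (projection_lipschitz convexA projA) risk_lipschitz.
by move=> /(_ (mulr_ge0 (ler0n R N) G0))/lipschitz_continuous.
Qed.

Lemma risk_minimum : exists2 z, A z & forall x, A x -> risk z <= risk x.
Proof.
pose K := closed_ball_ Num.norm (0 : 'rV[R]_N) D.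
have KE x : K x = (`|x| <= D) by rewrite /K/closed_ball_/= sub0r normrN.
have cK : compact K.
  apply: bounded_closed_compact; last exact: closed_closed_ball_.
  exists D; split=> [|y Dy x]; rewrite ?num_real// KE => /le_trans.
  by apply; exact: ltW.
have K0 : K !=set0.
  by exists (proj 0); rewrite KE; exact/boundedA/(projection_in projA).
have [z _ zmin] :=
  compact_EVT_min K0 cK (continuous_subspaceT risk_proj_continuous).
exists (proj z); first exact: projection_in projA z.
move=> x Ax; rewrite -(projection_id projA Ax).
by apply: zmin; rewrite inE KE; exact: boundedA.
Qed.

Lemma measurable_risk_comp (Y : Omega -> 'rV[R]_N) :
  measurable_coords Y -> (forall w, A (Y w)) ->
  measurable_fun setT (fun w => risk (Y w)).
Proof.
move=> mY AY; under eq_fun do rewrite -(projection_id projA (AY _)).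
exact: measurable_continuous_coords risk_proj_continuous mY.
Qed.

Lemma risk_comp_integrable (Y : Omega -> 'rV[R]_N) :
  measurable_coords Y -> (forall w, A (Y w)) ->
  P.-integrable setT (EFin \o (fun w => risk (Y w))).
Proof.
move=> mY AY; apply: (bounded_integrable P (b := L)).
  exact: measurable_risk_comp.
by move=> w; exact: risk_bounded.
Qed.

Variables (step : nat -> R) (x1 : 'rV[R]_N) (X : nat -> 'I_M -> Omega -> S).
Hypothesis M0 : (0 < M)%N.
Hypothesis b0 : 0 < b.
Hypothesis stepE : forall n, step n = b / (G * Num.sqrt n.+1%:R).
Hypothesis Ax1 : A x1.
Hypothesis mX : forall n m, measurable_fun setT (X n m).
Hypothesis lawX : forall n m (B : set S), measurable B ->
  P (X n m @^-1` B) = P (eps @^-1` B).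
Hypothesis indX : mutually_independent P (fun s : nat * 'I_M => X s.1 s.2).

Local Notation x_ n w := (sgd proj step slope x1 (fun k m => X k m w) n).
Local Notation mean_ J w := (average (fun n : 'I_J => x_ n w)).

Lemma sgd_iterate_in n w : A (x_ n w).
Proof. by apply: sgd_in => //; exact: projection_in. Qed.

Lemma sgd_mean_in J w : A (mean_ J.+1 w).
Proof. exact: (convex_set_average J convexA (sgd_iterate_in ^~ w)). Qed.

Lemma measurable_sgd_iterate n : measurable_coords (fun w => x_ n w).
Proof.
apply: measurable_sgd => //; first exact: projection_continuous convexA projA.
exact: oracle_slope_measurable oracle.
Qed.

Lemma measurable_sgd_mean J : measurable_coords (fun w => mean_ J w).
Proof. by apply: measurable_average => n; exact: measurable_sgd_iterate. Qed.

Lemma sample_independent_of_iterate n m (B : set S) (C : set (N.-tuple R)) :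
  measurable B -> measurable C ->
  P (X n m @^-1` B `&` (fun w => row_tuple (x_ n w)) @^-1` C) =
  (P (X n m @^-1` B) * P ((fun w => row_tuple (x_ n w)) @^-1` C))%E.
Proof.
move=> mB mC; pose past (s : nat * 'I_M) := (s.1 < n)%N.
apply: (independent_g_sigma_cylinders (Q := past) (i := (n, m))
  (fun s => mX s.1 s.2) indX) => //; first by rewrite /past /= ltnn.
pose F := cylinders (fun s : nat * 'I_M => X s.1 s.2) past.
have mx : measurable_fun setT
    ((fun w => row_tuple (x_ n w)) : g_sigma_algebraType F -> N.-tuple R).
  apply: measurable_row_tuple; apply: measurable_sgd => //.
  - exact: projection_continuous convexA projA.
  - exact: oracle_slope_measurable oracle.
  - by move=> k m' kn; exact: (measurable_fun_cylinders (i := (k, m'))).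
exact: measurable_preimage mx mC.
Qed.

Lemma expected_loss_sample n m x : A x -> \int[P]_w loss (X n m w) x = risk x.
Proof.
move=> Ax; congr fine.
apply: (eq_law_integral (g := fun s => (loss s x)%:E)) => //; first exact: lawX.
apply/measurable_EFinP.
exact: (jointly_measurable_comp (E := id) (Y := fun=> x)
  (oracle_loss_measurable oracle)).
Qed.

Lemma loss_at_iterate_integrable n m :
  P.-integrable setT (EFin \o (fun w => loss (X n m w) (x_ n w))).
Proof.
apply: (loss_comp_integrable (mX n m)); first exact: measurable_sgd_iterate.
exact: sgd_iterate_in.
Qed.

Lemma risk_at_iterate_integrable n :
  P.-integrable setT (EFin \o (fun w => risk (x_ n w))).
Proof.
apply: risk_comp_integrable; first exact: measurable_sgd_iterate.
exact: sgd_iterate_in.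
Qed.

Lemma risk_of_mean_integrable J :
  P.-integrable setT (EFin \o (fun w => risk (mean_ J.+1 w))).
Proof.
apply: risk_comp_integrable; first exact: measurable_sgd_mean.
exact: sgd_mean_in.
Qed.

Lemma expected_loss_at_iterate n m :
  \int[P]_w loss (X n m w) (x_ n w) = \int[P]_w risk (x_ n w).
Proof.
congr fine; pose phi (z : S * N.-tuple R) := (loss z.1 (tvec z.2))%:E.
transitivity (\int[P]_w phi (X n m w, row_tuple (x_ n w)))%E.
  by apply: eq_integral => w _; rewrite /phi/= row_tupleK.
rewrite (independent_integral (phi := phi) (mX n m)
  (measurable_row_tuple (measurable_sgd_iterate n))
  (@sample_independent_of_iterate n m)).
- apply: eq_integral => w _; have Ax := sgd_iterate_in n w.
  rewrite -(expected_loss_sample n m Ax) fineK.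
    by apply: eq_integral => w' _; rewrite /phi/= row_tupleK.
  exact: integrable_fin_num (loss_integrable (mX n m) Ax).
- by apply/measurable_EFinP; exact: oracle_loss_measurable oracle.
- rewrite /phi/=; under eq_fun do rewrite row_tupleK.
  exact: loss_at_iterate_integrable.
Qed.

Local Notation rate := (regret_rate N D G b).
Local Notation excess z n m w := (loss (X n m w) (x_ n w) - loss (X n m w) z).

Lemma pathwise_regret z J w : A z ->
  \sum_(n < J) average (fun m => excess z n m w) <= rate * Num.sqrt J%:R.
Proof.
move=> Az; apply: (@le_trans _ _ (\sum_(n < J)
    dotp (batch_slope slope (X n ^~ w) (x_ n w)) (x_ n w - z))).
  apply: ler_sum => n _; rewrite dotpZl dotp_suml.
  apply: ler_wpM2l; first by rewrite invr_ge0.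
  apply: ler_sum => m _.
  have := oracle_subgradient oracle (X n m w) (sgd_iterate_in n w) Az.
  by rewrite -opprB dotpNr; lra.
apply: (projected_subgradient_regret (x := fun n => x_ n w)
  (g := fun n => batch_slope slope (X n ^~ w) (x_ n w)) convexA projA) => //.
- by move=> n; exact: sgd_iterate_in.
- move=> n; apply: normr_average_le => // m.
  exact/(oracle_slope_bounded oracle)/sgd_iterate_in.
- by move=> n /=; rewrite stepE.
Qed.

Lemma expected_regret z J : A z ->
  \sum_(n < J) (\int[P]_w risk (x_ n w) - risk z) <= rate * Num.sqrt J%:R.
Proof.
move=> Az.
have iexcess n m : P.-integrable setT (EFin \o (fun w => excess z n m w)).
  exact: (integrableB measurableT (loss_at_iterate_integrable n m)
    (loss_integrable (mX n m) Az)).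
have ibatch n : P.-integrable setT
    (EFin \o (fun w => average (fun m => excess z n m w))).
  exact: (integrable_average measurableT).
have -> : \sum_(n < J) (\int[P]_w risk (x_ n w) - risk z) =
    \int[P]_w \sum_(n < J) average (fun m => excess z n m w).
  rewrite Rintegral_sum//.
  apply: eq_bigr => n _; rewrite Rintegral_average//.
  rewrite -[LHS](average_cst _ M0); congr (_ *: _); apply: eq_bigr => m _.
  rewrite RintegralB//; last 2 first.
  - exact: loss_at_iterate_integrable.
  - exact: loss_integrable.
  by rewrite expected_loss_at_iterate expected_loss_sample.
apply: Rintegral_le_cst => [|w]; last exact: pathwise_regret.
by apply: (integrable_sumr measurableT) => n; exact: ibatch.
Qed.

Lemma expected_risk_mean_le z J : A z ->
  \int[P]_w risk (mean_ J.+1 w) <= risk z + rate / Num.sqrt J.+1%:R.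
Proof.
move=> Az.
apply: (@le_trans _ _ (average (fun n : 'I_J.+1 => \int[P]_w risk (x_ n w)))).
  rewrite -(Rintegral_average measurableT); last first.
    by move=> n; exact: risk_at_iterate_integrable.
  apply: le_Rintegral => //.
  - exact: risk_of_mean_integrable.
  - apply: (integrable_average measurableT) => n.
    exact: risk_at_iterate_integrable.
  - move=> w _; apply: (convex_function_average J convexA risk_convex).
    exact: (sgd_iterate_in ^~ w).
have := expected_regret J.+1 Az; set q := Num.sqrt J.+1%:R.
have q_neq0 : q != 0 by rewrite sqrtr_eq0 -ltNge ltr0n.
have q_sqr : q ^+ 2 = J.+1%:R by rewrite sqr_sqrtr.
rewrite sumrB sumr_const card_ord -[X in _ - X]mulr_natl lerBlDl => regret.
rewrite /average -[_ *: _]/(_ * _) ler_pdivrMl ?ltr0n// (le_trans regret)//.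
by rewrite mulrDr lerD2l -[X in X * (_ / _)]q_sqr expr2 [leRHS]mulrCA mulfK.
Qed.

Lemma sgd_mean_cvg z : A z -> (forall x, A x -> risk z <= risk x) ->
  (\int[P]_w (risk (mean_ J w))%:E @[J --> \oo] --> (risk z)%:E)%E.
Proof.
move=> Az zmin; rewrite -cvg_shiftS.
rewrite [X in X @ _](_ : _ = fun J => (\int[P]_w risk (mean_ J.+1 w))%:E);
  last first.
  apply/funext => J; rewrite fineK//.
  exact: integrable_fin_num (risk_of_mean_integrable J).
apply: cvg_EFin; first by near=> J.
have upper_cvg : risk z + rate / Num.sqrt J.+1%:R @[J --> \oo] --> risk z.
  have harmonic_sqrt_cvg : Num.sqrt (harmonic J) @[J --> \oo] --> (0 : R).
    rewrite -[X in _ --> X]sqrtr0.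
    exact: (cvg_comp _ _ (@cvg_harmonic R) (@sqrt_continuous R 0)).
  rewrite -[X in _ --> X]addr0 -(mulr0 rate); apply: cvgD; first exact: cvg_cst.
  apply: cvgM; first exact: cvg_cst.
  by under eq_fun do rewrite -sqrtrV//.
apply: (squeeze_cvgr _ (cvg_cst (risk z)) upper_cvg).
near=> J; apply/andP; split; last exact: expected_risk_mean_le.
apply: cst_le_Rintegral => [|w]; first exact: risk_of_mean_integrable.
exact/zmin/sgd_mean_in.
Unshelve. all: by end_near. Qed.

End sgd_convergence.

(** * The cost of the mining facility *)

Lemma homo_leq_interval (R : numDomainType) (f : nat -> R) (a b : nat) :
  (forall m, (a <= m < b)%N -> f m <= f m.+1) ->
  forall i j, (a <= i)%N -> (i <= j)%N -> (j <= b)%N -> f i <= f j.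
Proof.
move=> f_le i j ai ij jb.
apply: (@homo_leq_in _ [pred m | (a <= m <= b)%N] f (fun x y => x <= y)) => //.
- by move=> y x z; exact: le_trans.
- move=> x y /andP[ax _] /andP[_ yb] k /andP[xk ky].
  by rewrite inE (leq_trans ax (ltnW xk)) (leq_trans (ltnW ky) yb).
- by move=> m /andP[am _] /andP[_ mb]; apply: f_le; rewrite am.
- by rewrite inE ai (leq_trans ij jb).
- by rewrite inE jb (leq_trans ai ij).
Qed.

Section feasible_region.
Context (R : realType) (N : nat) (CM : R).

Lemma inF_convex : convex_set (@inF R N CM).
Proof.
apply/convex_setP => x y t /andP[t0 t1] [x0 xC] [y0 yC].
rewrite -subr_ge0 in t1; split=> [i|].
  by rewrite !mxE addr_ge0// mulr_ge0.
under eq_bigr do rewrite !mxE.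
rewrite big_split/= -!mulr_sumr.
have -> : CM = t * CM + (1 - t) * CM by ring.
by rewrite lerD// ler_wpM2l.
Qed.

Lemma inF_bounded (c : 'rV[R]_N) : inF CM c -> `|c| <= CM.
Proof.
move=> [c0 cC]; apply: normr_le_coord => [|i].
  by apply: le_trans cC; exact: sumr_ge0.
rewrite ger0_norm//; apply: le_trans cC.
by rewrite (bigD1 i)//= lerDl sumr_ge0.
Qed.

Lemma inF0 : 0 <= CM -> inF CM (0 : 'rV[R]_N).
Proof.
by move=> CM0; split=> [i|]; rewrite ?mxE// big1// => i _; rewrite mxE.
Qed.

End feasible_region.

Definition unit_box (R : realType) (N : nat) : set (N.-tuple R) :=
  [set e | forall i, 0 <= tnth e i <= 1].

Definition capacity (R : realType) (cM : nat -> R) (q : nat) : R :=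
  \sum_(k < q) cM k.

Definition deployed (R : realType) (N : nat) (e : N.-tuple R)
    (c : 'rV[R]_N) : R :=
  \sum_(i < N) tnth e i * c 0 i.

Section cost.
Context (R : realType) (K N : nat) (cM r : nat -> R) (p : 'rV[R]_N).
Hypothesis K0 : (0 < K)%N.
Hypothesis cM0 : forall k, (k < K)%N -> 0 < cM k.
Hypothesis r0 : 0 <= r 0%N.
Hypothesis rS : forall k, (k.+1 < K)%N -> r k < r k.+1.
Hypothesis p0 : forall i, 0 <= p 0 i.
Implicit Types (e : N.-tuple R) (c : 'rV[R]_N).

Local Notation CM := (capacity cM K).
Local Notation slope_bound := (Num.max (r K.-1) (pmax p)).

Definition cost_of_type k e c : R :=
  \sum_(j < k) (r j - r k) * cM j +
  \sum_(i < N) c 0 i * (r k * tnth e i - p 0 i).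

Definition cost_slope e c : 'rV[R]_N := r (kcrit K cM e c) *: tvec e - p.

Lemma capacity_le m n :
  (m <= n)%N -> (n <= K)%N -> capacity cM m <= capacity cM n.
Proof.
move=> mn nK; apply: (homo_leq_interval (a := 0) (b := K)) => // q /= qK.
by rewrite /capacity big_ord_recr/= lerDl ltW// cM0.
Qed.

Lemma capacity_gt0 : 0 < CM.
Proof.
apply: lt_le_trans (capacity_le K0 (leqnn K)).
by rewrite /capacity big_ord1 cM0.
Qed.

Lemma reward_itv k : (k < K)%N -> 0 <= r k <= r K.-1.
Proof.
move=> kK.
have r_le i j : (i <= j)%N -> (j <= K.-1)%N -> r i <= r j.
  apply: (homo_leq_interval (a := 0)) => // m /= mK.
  by rewrite ltW// rS// -ltn_predRL.
have kK1 : (k <= K.-1)%N by rewrite -ltnS prednK.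
by rewrite (le_trans r0 (r_le 0%N k _ _))//= r_le.
Qed.

Lemma kcrit_lt e c : unit_box e -> inF CM c -> (kcrit K cM e c < K)%N.
Proof.
move=> ue [c0 cC]; rewrite /kcrit -{2}(size_iota 0 K) -has_find.
apply/hasP; exists K.-1; first by rewrite mem_iota add0n/= prednK.
rewrite prednK//; apply: le_trans cC; apply: ler_sum => i _.
by have /andP[_ e1] := ue i; rewrite -[leRHS]mul1r ler_wpM2r.
Qed.

Lemma before_kcrit e c q :
  (q < kcrit K cM e c)%N -> capacity cM q.+1 < deployed e c.
Proof.
move=> qk; have qK : (q < K)%N.
  by rewrite (leq_trans qk)// -[leqRHS](size_iota 0) find_size.
by have := before_find 0 qk; rewrite nth_iota//= add0n ltNge => ->.
Qed.

Lemma at_kcrit e c : (kcrit K cM e c < K)%N ->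
  deployed e c <= capacity cM (kcrit K cM e c).+1.
Proof.
move=> kK; have := kK; rewrite /kcrit -{2}(size_iota 0 K) -has_find.
by move=> /(nth_find 0); rewrite nth_iota.
Qed.

Lemma cost_of_typeS k e c : cost_of_type k.+1 e c - cost_of_type k e c =
  (r k.+1 - r k) * (deployed e c - capacity cM k.+1).
Proof.
rewrite /cost_of_type /deployed /capacity !big_ord_recr/=.
rewrite mulrBr !mulrDr !mulr_sumr.
have -> : \sum_(j < k) (r j - r k.+1) * cM j =
    \sum_(j < k) (r j - r k) * cM j - \sum_(j < k) (r k.+1 - r k) * cM j.
  by rewrite -sumrB; apply: eq_bigr => j _; ring.
have -> : \sum_(i < N) c 0 i * (r k.+1 * tnth e i - p 0 i) =
    \sum_(i < N) c 0 i * (r k * tnth e i - p 0 i) +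
    \sum_(i < N) (r k.+1 - r k) * (tnth e i * c 0 i).
  by rewrite -big_split; apply: eq_bigr => i _ /=; ring.
ring.
Qed.

Lemma cost_of_type_le_cost k e c : unit_box e -> inF CM c -> (k < K)%N ->
  cost_of_type k e c <= cost K cM r p e c.
Proof.
move=> ue Fc kK; rewrite -[leRHS]/(cost_of_type (kcrit K cM e c) e c).
have kcK := kcrit_lt ue Fc; set kc := kcrit K cM e c in kcK *.
have reward_step q : (q.+1 < K)%N -> 0 <= r q.+1 - r q.
  by move=> qK; rewrite subr_ge0 ltW// rS.
have [kkc|kck] := leqP k kc.
- pose f m := cost_of_type m e c.
  apply: (homo_leq_interval (f := f) (a := 0) (b := kc)) => // m /= mkc.
  rewrite -subr_ge0 cost_of_typeS mulr_ge0//.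
    by apply: reward_step; exact: leq_ltn_trans kcK.
  by rewrite subr_ge0 ltW// before_kcrit.
- pose f m := - cost_of_type m e c; rewrite -lerN2.
  apply: (homo_leq_interval (f := f) (a := kc) (b := K.-1)) => //.
  + move=> m /andP[kcm mK]; have {}mK : (m.+1 < K)%N by rewrite -ltn_predRL.
    rewrite lerN2 -subr_ge0 -opprB cost_of_typeS -mulrN opprB.
    rewrite mulr_ge0 ?reward_step// subr_ge0 (le_trans (at_kcrit kcK))//.
    by rewrite capacity_le// ltnW.
  + exact: ltnW.
  + by rewrite -ltnS prednK.
Qed.

Lemma cost_subgradient e : unit_box e ->
  subgradient_on (inF CM) (cost K cM r p e) (cost_slope e).
Proof.
move=> ue c c' Fc Fc'.
apply: le_trans (cost_of_type_le_cost ue Fc' (kcrit_lt ue Fc)).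
rewrite le_eqVlt; apply/orP; left; apply/eqP.
rewrite /cost /cost_of_type /= -addrA; congr (_ + _).
by rewrite /dotp -big_split/=; apply: eq_bigr => i _; rewrite !mxE; ring.
Qed.

Lemma slope_bound_ge0 : 0 <= slope_bound.
Proof.
have /reward_itv/andP[rK0 _] : (K.-1 < K)%N by rewrite prednK.
by rewrite le_max rK0.
Qed.

Lemma cost_slope_bounded e c :
  unit_box e -> inF CM c -> `|cost_slope e c| <= slope_bound.
Proof.
move=> ue Fc; apply: normr_le_coord slope_bound_ge0 _ => i.
have /andP[rk0 rkK] := reward_itv (kcrit_lt ue Fc).
have /andP[e0 e1] := ue i; have pi0 := p0 i.
have r_le : r K.-1 <= slope_bound by rewrite le_max lexx.
have p_le_pmax : p 0 i <= pmax p by exact: le_bigmax.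
have p_le : p 0 i <= slope_bound by rewrite le_max p_le_pmax orbT.
by rewrite !mxE ler_norml; apply/andP; split; nra.
Qed.

Lemma cost0 e : cost K cM r p e 0 = 0.
Proof.
have kcrit0 : kcrit K cM e 0 = 0%N.
  rewrite /kcrit -(prednK K0)/= [X in if X then _ else _](_ : _ = true)//.
  by rewrite big1 ?big_ord1 ?ltW ?cM0// => i _; rewrite mxE mulr0.
by rewrite /cost kcrit0 big_ord0 add0r big1// => i _; rewrite mxE mul0r.
Qed.

Lemma cost_bounded e c : unit_box e -> inF CM c ->
  `|cost K cM r p e c| <= N%:R * slope_bound * CM.
Proof.
move=> ue Fc.
have cost_lip := subgradient_lipschitz (cost_subgradient ue)
  (fun c => @cost_slope_bounded e c ue).
have := cost_lip (c, 0) (conj Fc (inF0 N (ltW capacity_gt0))).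
rewrite /= cost0 !subr0 => /le_trans; apply.
by rewrite ler_wpM2l ?inF_bounded// mulr_ge0 ?slope_bound_ge0.
Qed.

End cost.

Lemma measurable_find (d : measure_display) (T : measurableType d) (I : Type)
    (s : seq I) (a : T -> I -> bool) :
  (forall i, measurable_fun setT (fun w => a w i)) ->
  measurable_fun setT (fun w => find (a w) s).
Proof.
move=> ma; elim: s => [|i s IH]/=; first exact: measurable_cst.
apply: measurable_fun_ifT => //.
exact: (measurableT_comp (f := S)).
Qed.

Section measurable_cost.
Context (d : measure_display) (T : measurableType d) (R : realType) (N : nat).
Variables (E : T -> N.-tuple R) (C : T -> 'rV[R]_N).
Hypothesis mE : measurable_fun setT E.
Hypothesis mC : measurable_coords C.

Lemma measurable_kcrit (K : nat) (cM : nat -> R) :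
  measurable_fun setT (fun w => kcrit K cM (E w) (C w)).
Proof.
pose a w q := deployed (E w) (C w) <= capacity cM q.+1.
apply: (measurable_find (iota 0 K) (a := a)) => q.
apply: measurable_fun_ler => //; apply: measurable_sum => i.
by apply: measurable_funM => //; exact: measurable_tnth_comp.
Qed.

Lemma measurable_comp_kcrit (K : nat) (cM f : nat -> R) :
  measurable_fun setT (fun w => f (kcrit K cM (E w) (C w))).
Proof.
by apply: (measurableT_comp (f := f)) => //; exact: measurable_kcrit.
Qed.

Lemma measurable_cost (K : nat) (cM r : nat -> R) (p : 'rV[R]_N) :
  measurable_fun setT (fun w => cost K cM r p (E w) (C w)).
Proof.
apply: measurable_funD.
  pose f k := \sum_(j < k) (r j - r k) * cM j.
  exact: (measurable_comp_kcrit K cM f).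
apply: measurable_sum => i; apply: measurable_funM => //.
apply: measurable_funB => //; apply: measurable_funM.
  exact: measurable_comp_kcrit.
exact: measurable_tnth_comp.
Qed.

Lemma measurable_cost_slope (K : nat) (cM r : nat -> R) (p : 'rV[R]_N) :
  measurable_coords (fun w => cost_slope K cM r p (E w) (C w)).
Proof.
move=> i; under eq_fun do rewrite !mxE.
apply: measurable_funB => //; apply: measurable_funM.
  exact: measurable_comp_kcrit.
exact: measurable_tnth_comp.
Qed.

End measurable_cost.

Definition clip (R : realType) (N : nat) (e : N.-tuple R) : N.-tuple R :=
  [tuple Num.max 0 (Num.min 1 (tnth e i)) | i < N].

Section clip.
Context (R : realType) (N : nat).
Implicit Type e : N.-tuple R.

Lemma unit_box_clip e : unit_box (clip e).
Proof.
by move=> i; rewrite tnth_mktuple le_max lexx/= ge_max ler01 ge_min lexx.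
Qed.

Lemma clip_id e : unit_box e -> clip e = e.
Proof.
move=> ue; apply: eq_from_tnth => i; have /andP[e0 e1] := ue i.
by rewrite tnth_mktuple min_r// max_r.
Qed.

Lemma measurable_clip : measurable_fun setT (@clip R N).
Proof.
apply/measurable_fun_tnthP => i.
rewrite (_ : _ \o _ = fun e : N.-tuple R =>
    Num.max 0 (Num.min 1 (tnth e i))); last first.
  by apply/funext => e; exact: tnth_mktuple.
apply: measurable_maxr => //; apply: measurable_minr => //.
exact: measurable_tnth.
Qed.

Lemma measurable_unit_box : measurable (@unit_box R N).
Proof.
rewrite (_ : @unit_box R N = \bigcap_(i : 'I_N)
    (fun e : N.-tuple R => tnth e i) @^-1` `[0, 1]%classic); last first.
  apply/seteqP; split=> [e ue i _|e ue i]; have := ue i;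
    by rewrite /= in_itv/=; exact.
apply: fin_bigcap_measurable => // i _; apply: measurable_preimage.
  exact: measurable_tnth.
exact: measurable_itv.
Qed.

End clip.

Lemma ae_forall_countable (R : realType) (d : measure_display)
    (T : measurableType d) (mu : {measure set T -> \bar R}) (I : countType)
    (Q : I -> T -> Prop) :
  (forall i, {ae mu, forall w, Q i w}) -> {ae mu, forall w, forall i, Q i w}.
Proof.
move=> aeQ.
have : {ae mu, forall w, forall n i, unpickle n = Some i -> Q i w}.
  apply: ae_foralln => n; case: (unpickle n) => [i|]; last exact: aeW.
  by apply: filterS (aeQ i) => w Qw _ [<-].
by apply: filterS => w Qw i; exact: Qw (pickleK i).
Qed.

Lemma ae_preimage (R : realType) (d d' : measure_display)
    (Omega : measurableType d) (T : measurableType d') (P : probability Omega R)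
    (E : Omega -> T) (B : set T) :
  measurable_fun setT E -> measurable B -> P (E @^-1` B) = 1%E ->
  {ae P, forall w, B (E w)}.
Proof.
move=> mE mB PB; have mEB := measurable_preimage mE mB.
exists (~` (E @^-1` B)); split => //; first exact: measurableC.
by rewrite probability_setC// PB subee.
Qed.

Section mining_facility.
Context (R : realType) (d : measure_display) (Omega : measurableType d)
  (P : probability Omega R) (K N M : nat) (cM r : nat -> R) (p : 'rV[R]_N)
  (eps : Omega -> N.-tuple R) (X : nat -> 'I_M -> Omega -> N.-tuple R)
  (proj : 'rV[R]_N -> 'rV[R]_N) (c1 : 'rV[R]_N).
Hypotheses (K0 : (0 < K)%N) (N0 : (0 < N)%N) (M0 : (0 < M)%N).
Hypothesis cM0 : forall k, (k < K)%N -> 0 < cM k.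
Hypothesis r0 : 0 <= r 0%N.
Hypothesis rS : forall k, (k.+1 < K)%N -> r k < r k.+1.
Hypothesis p0 : forall i, 0 <= p 0 i.
Hypothesis meps : measurable_fun setT eps.
Hypothesis ae_eps : {ae P, forall w, unit_box (eps w)}.
Hypothesis mX : forall n m, measurable_fun setT (X n m).
Hypothesis ae_X :
  {ae P, forall w, forall s : nat * 'I_M, unit_box (X s.1 s.2 w)}.
Hypothesis lawX : forall n m (B : set (N.-tuple R)), measurable B ->
  P (X n m @^-1` B) = P (eps @^-1` B).
Hypothesis indX : mutually_independent P (fun s : nat * 'I_M => X s.1 s.2).

Local Notation CM := (capacity cM K).
Local Notation slope_bound := (Num.max (r K.-1) (pmax p)).

Hypothesis projP : is_proj_F CM proj.
Hypothesis Fc1 : inF CM c1.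

Local Notation f := (fexp P K cM r p eps).
Local Notation cbar_ := (cbar K CM cM r p proj c1 X).
Local Notation step n := (stepsize K CM r p n.+1).

Lemma measurable_snd_tvec :
  measurable_coords (fun z : N.-tuple R * N.-tuple R => tvec z.2).
Proof.
by move=> i; under eq_fun do rewrite mxE; exact: measurable_tnth_comp.
Qed.

(* Outside the box [kcrit] may be [K], so clipping is what makes the cost convex
   and bounded for every sample; almost surely it changes nothing. *)
Definition clipped_cost (e : N.-tuple R) : 'rV[R]_N -> R :=
  cost K cM r p (clip e).
Definition clipped_slope (e : N.-tuple R) : 'rV[R]_N -> 'rV[R]_N :=
  cost_slope K cM r p (clip e).

Lemma clipped_cost_oracle : subgradient_oracle (inF CM)
  (N%:R * slope_bound * CM) slope_bound clipped_cost clipped_slope.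
Proof.
have mclip : measurable_fun setT (fun z : N.-tuple R * N.-tuple R => clip z.1).
  exact: (measurableT_comp (@measurable_clip R N)).
split.
- by move=> e; exact: cost_subgradient (unit_box_clip e).
- by move=> e c; exact: cost_bounded (unit_box_clip e).
- by move=> e c; exact: cost_slope_bounded (unit_box_clip e).
- exact: measurable_cost mclip measurable_snd_tvec _ _ _ _.
- exact: measurable_cost_slope mclip measurable_snd_tvec _ _ _ _.
Qed.

Local Notation clipped_risk := (risk P clipped_cost eps).

Lemma fexp_clipped : f = clipped_risk.
Proof.
apply/funext => c; congr fine; apply: ae_eq_integral => //.
- by apply/measurable_EFinP/measurable_cost => // i; exact: measurable_cst.
- apply/measurable_EFinP/measurable_cost => [|i]; last exact: measurable_cst.
  exact: (measurableT_comp (@measurable_clip R N)).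
- by apply: filterS ae_eps => w uw _ /=; rewrite /clipped_cost clip_id.
Qed.

Lemma fexp_convex : convex_on_F CM f.
Proof.
have /convex_functionP convex_risk :=
  risk_convex P (@inF_convex R N CM) clipped_cost_oracle meps.
by move=> c c' t Fc Fc' t01; rewrite fexp_clipped; exact: convex_risk.
Qed.

Lemma fexp_minimum : exists2 c, inF CM c & forall c', inF CM c' -> f c <= f c'.
Proof.
rewrite fexp_clipped.
exact: (risk_minimum P (@inF_convex R N CM) projP (@inF_bounded R N CM)
  clipped_cost_oracle meps).
Qed.

Local Notation sgd_ slope n w :=
  (sgd proj (fun n => step n) slope c1 (fun k m => X k m w) n).

Lemma cbarE J w :
  cbar_ J w = average (fun n : 'I_J => sgd_ (cost_slope K cM r p) n w).
Proof.
congr (_ *: _); apply: eq_bigr => n _.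
by elim: (nat_of_ord n) => [//|k /= ->].
Qed.

Lemma ae_cbar_clipped : {ae P, forall w, forall J,
  cbar_ J w = average (fun n : 'I_J => sgd_ clipped_slope n w)}.
Proof.
apply: filterS ae_X => w uX J; rewrite cbarE.
congr (_ *: _); apply: eq_bigr => n _; apply: eq_sgd => // k m c.
by rewrite /clipped_slope clip_id//; exact: (uX (k, m)).
Qed.

Lemma measurable_clipped_risk_mean J
    (slope : N.-tuple R -> 'rV[R]_N -> 'rV[R]_N) :
  (forall i, jointly_measurable (fun e c => slope e c 0 i)) ->
  measurable_fun setT
    (fun w => (clipped_risk (average (fun n : 'I_J => sgd_ slope n w)))%:E).
Proof.
move=> mslope; case: J => [|J].
  by under eq_fun do rewrite /average big_ord0; exact: measurable_cst.
apply/measurable_EFinP.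
apply: (measurable_risk_comp P (@inF_convex R N CM) projP
  clipped_cost_oracle meps).
  apply: measurable_average => n; apply: measurable_sgd => //.
  exact: projection_continuous (@inF_convex R N CM) projP.
move=> w; apply: (convex_set_average J (x := fun n => sgd_ slope n w)).
  exact: inF_convex.
by move=> n; apply: sgd_in => //; exact: projection_in projP.
Qed.

Lemma stepsizeE n : step n =
  (if N == 1%N then CM else Num.sqrt 2 * CM) / Num.sqrt N%:R /
  (slope_bound * Num.sqrt n.+1%:R).
Proof. by rewrite /stepsize -[RHS]mulrA -invfM [in RHS]mulrA. Qed.

Lemma expected_fexp_cbar_cvg z :
  inF CM z -> (forall c, inF CM c -> f z <= f c) ->
  (\int[P]_w (f (cbar_ J w))%:E @[J --> \oo] --> (f z)%:E)%E.
Proof.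
rewrite fexp_clipped => Fz zmin.
have scale_gt0 : 0 < (if N == 1%N then CM else Num.sqrt 2 * CM) / Num.sqrt N%:R.
  rewrite divr_gt0 ?sqrtr_gt0 ?ltr0n//.
  by case: ifP => _; rewrite ?mulr_gt0 ?sqrtr_gt0// capacity_gt0.
have expected_eq J : (\int[P]_w (clipped_risk (cbar_ J w))%:E =
    \int[P]_w (clipped_risk
      (average (fun n : 'I_J => sgd_ clipped_slope n w)))%:E)%E.
  apply: ae_eq_integral => //.
  - under eq_fun do rewrite cbarE; apply: measurable_clipped_risk_mean.
    exact: (measurable_cost_slope measurable_fst measurable_snd_tvec).
  - apply: measurable_clipped_risk_mean.
    exact: oracle_slope_measurable clipped_cost_oracle.
  - by apply: filterS ae_cbar_clipped => w cbar_eq _; rewrite cbar_eq.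
under eq_fun do rewrite expected_eq.
exact: (sgd_mean_cvg (@inF_convex R N CM) projP (@inF_bounded R N CM)
  clipped_cost_oracle meps M0 scale_gt0 stepsizeE Fc1 mX lawX indX Fz zmin).
Qed.

End mining_facility.

Theorem theorem2 (R : realType) (d : measure_display) (Omega : measurableType d)
  (P : probability Omega R) (K N M : nat) (cM r : nat -> R) (p : 'rV[R]_N)
  (eps : Omega -> N.-tuple R) (X : nat -> 'I_M -> Omega -> N.-tuple R)
  (proj : 'rV[R]_N -> 'rV[R]_N) (c1 : 'rV[R]_N) :
  (0 < K)%N -> (0 < N)%N -> (0 < M)%N ->
  (forall k, (k < K)%N -> 0 < cM k) ->
  0 <= r 0%N ->
  (forall k, (k.+1 < K)%N -> r k < r k.+1) ->
  (forall i, 0 <= p 0 i) ->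
  measurable_fun setT eps ->
  P [set w | forall i, 0 <= tnth (eps w) i <= 1] = 1%E ->
  (forall n m, measurable_fun setT (X n m)) ->
  (forall n m (B : set (N.-tuple R)), measurable B ->
     P (X n m @^-1` B) = P (eps @^-1` B)) ->
  mutually_independent P (fun s : nat * 'I_M => X s.1 s.2) ->
  is_proj_F (\sum_(k < K) cM k) proj ->
  inF (\sum_(k < K) cM k) c1 ->
  convex_on_F (\sum_(k < K) cM k) (fexp P K cM r p eps) /\
  exists cstar : 'rV[R]_N,
    [/\ inF (\sum_(k < K) cM k) cstar,
        (forall c, inF (\sum_(k < K) cM k) c ->
           fexp P K cM r p eps cstar <= fexp P K cM r p eps c) &
        ((fun J : nat => \int[P]_w
            (fexp P K cM r p eps
               (cbar K (\sum_(k < K) cM k) cM r p proj c1 X J w))%:E)%E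
          @ \oo --> (fexp P K cM r p eps cstar)%:E)%E].
Proof.
move=> K0 N0 M0 cM0 r0 rS p0 meps eps_box mX lawX indX projP Fc1.
have ae_eps : {ae P, forall w, unit_box (eps w)}.
  exact: ae_preimage (@measurable_unit_box R N) eps_box.
have ae_X : {ae P, forall w, forall s : nat * 'I_M, unit_box (X s.1 s.2 w)}.
  apply: ae_forall_countable => s; apply: ae_preimage => //.
    exact: measurable_unit_box.
  by rewrite lawX//; exact: measurable_unit_box.
split; first exact: fexp_convex.
have [cstar Fcstar cstar_min] :=
  fexp_minimum K0 cM0 r0 rS p0 meps ae_eps projP.
exists cstar; split => //.
exact: expected_fexp_cbar_cvg.
Qed.
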